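(* Let $m,n\geq 5$ be integers and let $T_{m,n}=C_m\square C_n$ be the torus grid graph (Cartesian product of the cycles on $m$ and $n$ vertices). Then $\pi_{\mathrm{opt}}(T_{m,n})\geq \frac{2}{13}nm$.
   Context: A pebble distribution on a graph $G$ is a function $P:V(G)\to\mathbb{Z}_{\geq 0}$; its size is $|P|=\sum_v P(v)$. A pebbling move from a vertex $u$ with at least two pebbles to an adjacent vertex $v$ removes two pebbles from $u$ and adds one pebble to $v$. A vertex is reachable under $P$ if some sequence of pebbling moves (each executable, i.e. never making a pebble count negative) yields a distribution with at least one pebble on it. $P$ is solvable if every vertex is reachable. The optimal pebbling number $\pi_{\mathrm{opt}}(G)$ is the minimum size of a solvable distribution on $G$. The Cartesian product $G\square H$ has vertex set $V(G)\times V(H)$, with $(g_1,h_1)\sim(g_2,h_2)$ iff ($g_1g_2\in E(G)$ and $h_1=h_2$) or ($h_1h_2\in E(H)$ and $g_1=g_2$). *)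

(* Defs.v *)
From mathcomp Require Import all_boot.
From Stdlib Require Import Relations.

Set Implicit Arguments.
Unset Strict Implicit.
Unset Printing Implicit Defensive.

Definition cycle_adj (m : nat) : rel 'I_m :=
  fun i j => (j == (i.+1 %% m) :> nat) || (i == (j.+1 %% m) :> nat).

Definition cart_adj (T U : finType) (e : rel T) (f : rel U) : rel (T * U) :=
  fun x y => (e x.1 y.1 && (x.2 == y.2)) || (f x.2 y.2 && (x.1 == y.1)).

Definition torus_adj (m n : nat) : rel ('I_m * 'I_n) :=
  cart_adj (@cycle_adj m) (@cycle_adj n).

Definition distribution (V : finType) := {ffun V -> nat}.

Definition dsize (V : finType) (P : distribution V) : nat := \sum_(v : V) P v.

Definition pebbling_move (V : finType) (e : rel V) (P Q : distribution V) : Prop :=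
  exists u v : V, [/\ e u v, 2 <= P u &
    Q = [ffun w => (if w == v then (if w == u then P w - 2 else P w) + 1
                    else if w == u then P w - 2 else P w)]].

Definition pebbling_reach (V : finType) (e : rel V) : relation (distribution V) :=
  clos_refl_trans (distribution V) (@pebbling_move V e).

Definition reachable (V : finType) (e : rel V) (P : distribution V) (r : V) : Prop :=
  exists Q, pebbling_reach e P Q /\ 1 <= Q r.

Definition solvable (V : finType) (e : rel V) (P : distribution V) : Prop :=
  forall r : V, reachable e P r.

(* Main.v *)
(* Only vertices of the set S of 2-reachable vertices can ever send pebbles, so
   for v in S the potential sum_(u in S) Q(u) 2^(-d(u,v)), where d is the
   distance inside the subgraph induced by S, never increases and is at least 2
   for the initial distribution.  Each vertex x dominated by S is charged to an
   owner v in S (itself, or a neighbour when x is outside S), and these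
   inequalities are summed over all x.  A pebble at u contributes in total at
   most 13: the balls B of S around u satisfy |N[B]| <= 3|B| + 2, being
   connected in a 4-regular graph, and |N[B]| <= 2r^2 + 2r + 1, and these two
   bounds balance exactly at 13.  A vertex not dominated by S keeps a pebble of
   its own. *)
From Stdlib Require Import Relations.
Require Import Defs.
From mathcomp Require Import all_boot.
From mathcomp Require Import all_algebra.
From mathcomp Require Import boolp ring zify.

Set Implicit Arguments.
Unset Strict Implicit.
Unset Printing Implicit Defensive.

(** * Neighbourhoods, balls and distance weights in an induced subgraph *)

Section Graph.
Variables (V : finType) (e : rel V).

Definition closed_nbhd (B : {set V}) : {set V} :=
  B :|: [set x | [exists y in B, e y x]].

Lemma closed_nbhdP (B : {set V}) x :
  reflect (x \in B \/ exists2 y, y \in B & e y x) (x \in closed_nbhd B).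
Proof.
rewrite in_setU inE; apply: (iffP orP) => -[xB|H]; [by left| | by left|].
  by right; case/exists_inP: H => y yB eyx; exists y.
by right; case: H => y yB eyx; apply/exists_inP; exists y.
Qed.

Lemma closed_nbhdS (A B : {set V}) :
  A \subset B -> closed_nbhd A \subset closed_nbhd B.
Proof.
move=> /subsetP sAB; apply/subsetP => x /closed_nbhdP[xA|[y yA eyx]].
  by apply/closed_nbhdP; left; apply: sAB.
by apply/closed_nbhdP; right; exists y => //; apply: sAB.
Qed.

Lemma sub_closed_nbhd (B : {set V}) : B \subset closed_nbhd B.
Proof. exact: subsetUl. Qed.

Fixpoint ball (S : {set V}) (u : V) (d : nat) : {set V} :=
  if d is d'.+1 then S :&: closed_nbhd (ball S u d') else [set u].

Lemma ball_sub (S : {set V}) u d : u \in S -> ball S u d \subset S.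
Proof.
by move=> uS; case: d => [|d] /=; [rewrite sub1set | apply: subsetIl].
Qed.

Lemma ball_subS (S : {set V}) u d : u \in S -> ball S u d \subset ball S u d.+1.
Proof. by move=> uS /=; rewrite subsetI ball_sub //= sub_closed_nbhd. Qed.

Lemma center_in_ball (S : {set V}) u d : u \in S -> u \in ball S u d.
Proof.
move=> uS; elim: d => [|d IHd]; first by rewrite inE.
by apply: (subsetP (ball_subS d uS)).
Qed.

Lemma ball_edge (S : {set V}) u w d : w \in S -> e u w ->
  ball S w d \subset ball S u d.+1.
Proof.
move=> wS euw; elim: d => [|d IHd].
  rewrite sub1set in_setI wS; apply/closed_nbhdP; right.
  by exists u; rewrite ?inE.
exact: setIS (closed_nbhdS IHd).
Qed.

Lemma ball_mono (S T : {set V}) u d : S \subset T -> ball S u d \subset ball T u d.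
Proof.
by move=> sST; elim: d => [|d IHd] //=; apply: setISS => //; apply: closed_nbhdS.
Qed.

(* [(prox S u v D).+1] is [2 ^ (D - minn D d)], where [d] is the distance from
   [u] to [v] in the subgraph induced by [S]. *)
Fixpoint prox (S : {set V}) (u v : V) (D : nat) : nat :=
  if D is D'.+1 then 2 * prox S u v D' + (v \in ball S u D') else 0.

Lemma prox_self (S : {set V}) v D : v \in S -> (prox S v v D).+1 = 2 ^ D.
Proof.
move=> vS; elim: D => [|D IHD] //=.
by rewrite center_in_ball // expnS -IHD; lia.
Qed.

(** By [ball_edge], [prox S w v D] is at most [prox S u v D.+1], which unfolds to [2 * prox S u v D]
    plus at most one. *)
Lemma prox_edge (S : {set V}) u w v D : w \in S -> e u w ->
  (prox S w v D).+1 <= 2 * (prox S u v D).+1.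
Proof.
move=> wS euw.
have H : prox S w v D <= 2 * prox S u v D + (v \in ball S u D).
  elim: D => [|D IHD] //=; rewrite -/(ball S u D.+1).
  have := subsetP (ball_edge D wS euw) v.
  case: (v \in ball S w D) => [/(_ isT) ->|_]; lia.
move: H; case: (v \in _) => /=; lia.
Qed.

(** * Neighbourhood growth and the bound 13 *)

Section Growth.
Hypothesis e_sym : symmetric e.
Hypothesis ball_growth :
  forall u d, #|ball setT u d| <= 2 * d ^ 2 + 2 * d + 1.

Lemma card_closed_nbhd1 x : #|closed_nbhd [set x]| <= 5.
Proof. by have := ball_growth x 1; rewrite /= setTI. Qed.

(** Of the at most five vertices, [x] and a neighbour of it in [B] are already counted. *)
Lemma card_nbhd_diff (B : {set V}) x : x \in closed_nbhd B -> x \notin B ->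
  #|closed_nbhd [set x] :\: closed_nbhd B| <= 3.
Proof.
move=> xN xB; have := xN => /closed_nbhdP[|[y yB eyx]]; first by rewrite (negPf xB).
have neq_xy : x != y by apply: contraNneq xB => ->.
have sub2 : [set x; y] \subset closed_nbhd [set x] :&: closed_nbhd B.
  apply/subsetP => z /set2P[] ->; rewrite in_setI.
    by rewrite xN andbT; apply: (subsetP (sub_closed_nbhd _)); rewrite inE.
  rewrite (subsetP (sub_closed_nbhd B)) // andbT.
  by apply/closed_nbhdP; right; exists x; rewrite ?inE // e_sym.
have := subset_leq_card sub2; rewrite cards2 neq_xy /=.
have := cardsID (closed_nbhd B) (closed_nbhd [set x]); have := card_closed_nbhd1 x; lia.
Qed.

Lemma card_nbhd_ball (S : {set V}) u d : u \in S ->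
  #|closed_nbhd (ball S u d)| <= 3 * #|ball S u d| + 2.
Proof.
move=> uS; elim: d => [|d IHd]; first by rewrite /= cards1; apply: card_closed_nbhd1.
set B := ball S u d in IHd *; set B' := ball S u d.+1.
have sBB' : B \subset B' by apply: ball_subS.
have sub : closed_nbhd B' \subset
    closed_nbhd B :|: \bigcup_(x in B' :\: B) (closed_nbhd [set x] :\: closed_nbhd B).
  apply/subsetP => z zN; rewrite in_setU; case: (boolP (z \in closed_nbhd B)) => //= zB.
  have /closed_nbhdP[zB'|[y yB' eyz]] := zN.
    by move: zB'; rewrite /B' /= in_setI (negPf zB) andbF.
  apply/bigcupP; exists y.
    rewrite in_setD yB' andbT; apply: contraNN zB => yB.
    by apply/closed_nbhdP; right; exists y.
  by rewrite in_setD zB; apply/closed_nbhdP; right; exists y; rewrite ?inE.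
have cup : #|\bigcup_(x in B' :\: B) (closed_nbhd [set x] :\: closed_nbhd B)|
    <= 3 * #|B' :\: B|.
  rewrite mulnC -sum_nat_const.
  apply: leq_trans (_ : \sum_(x in B' :\: B) #|closed_nbhd [set x] :\: closed_nbhd B| <= _).
    elim/big_rec2: _ => [|x a b _ leb]; first by rewrite cards0.
    by apply: leq_trans (leq_card_setU _ _) _; rewrite leq_add2l.
  apply: leq_sum => x; rewrite in_setD => /andP[xB xB'].
  by apply: card_nbhd_diff => //; move: xB'; rewrite /B' /= in_setI => /andP[].
have := leq_trans (subset_leq_card sub) (leq_card_setU _ _).
have := cardsID B B'; rewrite (setIidPr sBB'); lia.
Qed.

Lemma card_nbhd_ball_growth (S : {set V}) u d :
  #|closed_nbhd (ball S u d)| <= 2 * d.+1 ^ 2 + 2 * d.+1 + 1.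
Proof.
apply: leq_trans (ball_growth u d.+1); apply: subset_leq_card.
by rewrite /= setTI; apply: closed_nbhdS; apply/ball_mono/subsetT.
Qed.

(** The default [x] is reached only outside [closed_nbhd S]. *)
Definition owner (S : {set V}) (x : V) : V :=
  if x \in S then x else odflt x [pick y in S | e y x].

Lemma owner_id (S : {set V}) x : x \in S -> owner S x = x.
Proof. by rewrite /owner => ->. Qed.

Lemma ownerP (S : {set V}) x : x \in closed_nbhd S ->
  owner S x \in S /\ x \in closed_nbhd [set owner S x].
Proof.
move=> /closed_nbhdP xN; rewrite /owner; case: ifP xN => [xS _|_ [//|[y yS eyx]]].
  by split=> //; apply: (subsetP (sub_closed_nbhd _)); rewrite inE.
case: pickP => [z /andP[zS ezx]|/(_ y)]; last by rewrite yS eyx.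
by split=> //=; apply/closed_nbhdP; right; exists z; rewrite ?inE.
Qed.

(** Inclusion-exclusion: the owned set and the next ball both lie in [closed_nbhd (ball S u d)], and
    they meet inside [ball S u d] because vertices of [S] own themselves. *)
Lemma card_owned (S : {set V}) u d : u \in S ->
  #|[set x in closed_nbhd S | owner S x \in ball S u d]| + #|ball S u d.+1|
    <= #|closed_nbhd (ball S u d)| + #|ball S u d|.
Proof.
move=> uS; set A := [set x in _ | _]; rewrite -cardsUI.
apply: leq_add; apply: subset_leq_card; apply/subsetP => x.
  rewrite in_setU => /orP[|/setIP[]//].
  rewrite inE => /andP[/ownerP[_ xN] oB].
  by apply: subsetP xN; apply: closed_nbhdS; rewrite sub1set.
rewrite in_setI => /andP[]; rewrite inE => /andP[_ oB] /setIP[xS _].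
by move: oB; rewrite owner_id.
Qed.

(* With [a], [b], [c] the numbers of owned, ball and neighbourhood vertices at
   stage [D], the step combines [c <= 3 * b + 2] and
   [c <= 2 * D.+1 ^ 2 + 2 * D.+1 + 1] with weights 1 and 2; the quadratic
   correction is the solution of the resulting recurrence, tight at [D = 0]. *)
Lemma prox_total (S : {set V}) u D : u \in S ->
  3 * (\sum_(x in closed_nbhd S) prox S u (owner S x) D + #|ball S u D|)
    + (4 * D ^ 2 + 20 * D + 36) <= 39 * 2 ^ D.
Proof.
move=> uS; elim: D => [|D IHD]; first by rewrite big1 // cards1.
have -> : \sum_(x in closed_nbhd S) prox S u (owner S x) D.+1 =
    2 * \sum_(x in closed_nbhd S) prox S u (owner S x) D
    + #|[set x in closed_nbhd S | owner S x \in ball S u D]|.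
  rewrite /= big_split /= -big_distrr /=; congr (_ + _).
  by rewrite -big_mkcondr /= sum1dep_card.
have := card_owned D uS; have := card_nbhd_ball D uS.
have := card_nbhd_ball_growth S u D; rewrite (expnS 2 D) -!mulnn; lia.
Qed.

Lemma prox_total_le (S : {set V}) u D : u \in S -> #|V| <= D ->
  \sum_(x in closed_nbhd S) (prox S u (owner S x) D).+1 <= 13 * 2 ^ D.
Proof.
(* The successors add at most [D] in total, which the term [20 * D] of [prox_total] absorbs. *)
move=> uS leVD; have := leq_trans (max_card (mem (closed_nbhd S))) leVD.
under eq_bigr do rewrite -addn1.
rewrite big_split /= sum1_card; have := prox_total D uS.
move: (\sum_(x in _) _) #|_| #|_| => z b c; rewrite -mulnn; lia.
Qed.

(** * Potentials of pebble distributions *)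

Variable P : distribution V.

Definition two_reachable : {set V} :=
  [set x | `[< exists Q, pebbling_reach e P Q /\ 2 <= Q x >]].

Lemma move_balance Q Q' : pebbling_move e Q Q' ->
  exists u v, [/\ e u v, 2 <= Q u &
    forall h : V -> nat, \sum_x Q' x * h x + 2 * h u = \sum_x Q x * h x + h v].
Proof.
move=> [u [v [euv Qu ->]]]; exists u, v; split=> // h.
have one w (k : nat) : k * h w = \sum_x (if x == w then k else 0) * h x.
  by rewrite (bigD1 w) //= eqxx big1 ?addn0 // => x /negPf ->.
rewrite (one u 2) -[h v]mul1n (one v 1) -!big_split /=; apply: eq_bigr => x _.
rewrite -!mulnDl; congr (_ * _); rewrite ffunE.
case: (eqVneq x u) => [->|_]; case: eqP => _; lia.
Qed.

Lemma potential_le (h : V -> nat) Q :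
  (forall u w, u \in two_reachable -> e u w -> h w <= 2 * h u) ->
  pebbling_reach e P Q -> \sum_x Q x * h x <= \sum_x P x * h x.
Proof.
(* Peeling off the last move keeps a prefix from [P], which witnesses that the source of that move
   is 2-reachable. *)
move=> hE PQ; have /clos_rt_rtn1_iff := PQ; elim=> // Q1 Q2 Q12 PQ1 IH.
have [u [v [euv Qu /(_ h)]]] := move_balance Q12.
have uS : u \in two_reachable.
  rewrite inE; apply/asboolP; exists Q1; split=> //.
  exact/clos_rt_rtn1_iff.
have := hE u v uS euv; lia.
Qed.

(** With the indicator of [x] as weight, no move can raise the potential: an edge from
    [two_reachable] to [x] would dominate [x]. *)
Lemma undominated_pebble x : reachable e P x ->
  x \notin closed_nbhd two_reachable -> 1 <= P x.
Proof.
move=> [Q [PQ Qx]] xN.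
have pick1 (R : distribution V) : \sum_y R y * (y == x) = R x.
  by rewrite (bigD1 x) //= eqxx muln1 big1 ?addn0 // => y /negPf ->; rewrite muln0.
apply: leq_trans Qx _; rewrite -(pick1 Q) -(pick1 P).
apply: potential_le PQ => u w uS euw.
case: eqP => [wx|//]; move/negP: xN; case; apply/closed_nbhdP.
by right; exists u => //; rewrite -wx.
Qed.

Lemma two_reachable_weight v D : v \in two_reachable ->
  2 * 2 ^ D <= \sum_(u in two_reachable) P u * (prox two_reachable u v D).+1.
Proof.
move=> vS; have := vS; rewrite inE => /asboolP[Q [PQ Qv]].
set S := two_reachable in vS *.
(* Vanishing off [S] makes the edge condition trivial for moves that leave [S]. *)
pose h u := (u \in S) * (prox S u v D).+1.
have PE (R : distribution V) :
    \sum_(u in S) R u * (prox S u v D).+1 = \sum_u R u * h u.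
  rewrite big_mkcond /=; apply: eq_bigr => u _; rewrite /h.
  by case: (u \in S); rewrite ?mul1n ?muln0.
rewrite PE; apply: leq_trans (potential_le _ PQ); last first.
  move=> u w uS euw; rewrite /h uS mul1n.
  by case: (boolP (w \in S)) => // wS; rewrite mul1n prox_edge.
rewrite -PE (bigD1 v) //= prox_self //.
by apply: leq_trans (leq_addr _ _); rewrite leq_mul2r Qv orbT.
Qed.

Lemma solvable_size : solvable e P -> 2 * #|V| <= 13 * dsize P.
Proof.
move=> solP; set S := two_reachable; set N := closed_nbhd S.
have inner : 2 * #|N| <= 13 * \sum_(u in S) P u.
  have : \sum_(x in N) 2 * 2 ^ #|V| <= \sum_(u in S) P u * (13 * 2 ^ #|V|).
    apply: leq_trans (_ : \sum_(x in N) \sum_(u in S)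
        P u * (prox S u (owner S x) #|V|).+1 <= _).
      apply: leq_sum => x /ownerP[oS _]; exact: two_reachable_weight.
    rewrite exchange_big /=; apply: leq_sum => u uS.
    by rewrite -big_distrr leq_mul2l prox_total_le ?orbT.
  rewrite sum_nat_const -big_distrl /= mulnA (mulnA _ 13).
  by rewrite leq_pmul2r ?expn_gt0 // mulnC (mulnC _ 13).
(* Since [S] lies in [N], these pebbles are disjoint from those counted in [inner]. *)
have outer : #|~: N| <= \sum_(u in ~: S) P u.
  rewrite -sum1_card; apply: leq_trans (_ : \sum_(u in ~: N) P u <= _).
    apply: leq_sum => x; rewrite in_setC => xN.
    exact: undominated_pebble (solP x) xN.
  rewrite big_mkcond [leqRHS]big_mkcond /=; apply: leq_sum => u _.
  rewrite !in_setC; case: (boolP (u \in N)) => //= uN.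
  by rewrite (contraNN (subsetP (sub_closed_nbhd S) u) uN).
have := cardsC N; have : dsize P = \sum_(u in S) P u + \sum_(u in ~: S) P u.
  rewrite /dsize (bigID (mem S)) /=; congr (_ + _).
  by apply: eq_bigl => u; rewrite in_setC.
lia.
Qed.

End Growth.
End Graph.

(** * Ball sizes in the torus *)

Section Torus.
Import GRing.Theory.
Local Open Scope ring_scope.
Variables m n : nat.
Implicit Types x y u : ('I_m.+2 * 'I_n.+2)%type.

Lemma cycle_adjE k (i j : 'I_k.+2) :
  cycle_adj i j = (j == i + 1) || (i == j + 1).
Proof.
have succ (a b : 'I_k.+2) : (b == (a.+1 %% k.+2)%N :> nat) = (b == a + 1).
  by rewrite -val_eqE /= [in RHS](modn_small (isT : 1 < k.+2)%N) addn1.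
by rewrite /cycle_adj !succ.
Qed.

Lemma torus_adj_sym : symmetric (@torus_adj m.+2 n.+2).
Proof.
move=> x y; rewrite /torus_adj /cart_adj /cycle_adj.
by rewrite (orbC (y.1 == _ :> nat)) (orbC (y.2 == _ :> nat)) (eq_sym y.1 x.1) (eq_sym y.2 x.2).
Qed.

(* Endpoints of walks of length [k - 1] from [u]: in the coordinates sum and
   difference every step changes both by 1 or -1. *)
Definition diamond u k : {set 'I_m.+2 * 'I_n.+2} :=
  [set (u.1 + (z.1 + z.2 + 1)%:R - k%:R, u.2 + z.1%:R - z.2%:R)
    | z : 'I_k * 'I_k].

Lemma diamondP u k x :
  reflect (exists p q, [/\ (p < k)%N, (q < k)%N &
             x = (u.1 + (p + q + 1)%:R - k%:R, u.2 + p%:R - q%:R)])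
          (x \in diamond u k).
Proof.
apply: (iffP imsetP) => [[[p q] _ ->]|[p [q [ltp ltq ->]]]].
  by exists p, q; rewrite !ltn_ord.
by exists (Ordinal ltp, Ordinal ltq).
Qed.

Lemma card_diamond u k : (#|diamond u k| <= k ^ 2)%N.
Proof.
apply: leq_trans (leq_imset_card _ _) _.
by rewrite card_prod card_ord mulnn.
Qed.

Lemma diamond_step u k x y :
  x \in diamond u k -> torus_adj x y -> y \in diamond u k.+1.
Proof.
case: y => y1 y2 /diamondP[p [q [ltp ltq ->]]]; rewrite /torus_adj /cart_adj /=.
rewrite !cycle_adjE => /orP[]/andP[/orP[]/eqP E1 /eqP E2]; apply/diamondP.
(* The four directions increment both, neither, the first or the second of [p] and [q]. *)
- by exists p.+1, q.+1; split=> //; congr pair; rewrite ?E1 -?E2; ring.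
- by exists p, q; split; rewrite ?ltnS 1?ltnW //; congr pair;
    [apply: (addIr 1); rewrite -E1; ring | rewrite -E2].
- by exists p.+1, q; split; rewrite // ?ltnS 1?ltnW //; congr pair;
    rewrite ?E1 -?E2; ring.
by exists p, q.+1; split; rewrite // ?ltnS 1?ltnW //; congr pair;
    [rewrite -E2; ring | apply: (addIr 1); rewrite -E1; ring].
Qed.

Lemma diamondSS u k : diamond u k \subset diamond u k.+2.
Proof.
apply/subsetP => x /diamondP[p [q [ltp ltq ->]]]; apply/diamondP.
exists p.+1, q.+1; split; rewrite ?ltnS 1?ltnW //.
by congr pair; ring.
Qed.

(** Walks of lengths [d] and [d - 1] cover both parities; shorter ones are padded by a
    back-and-forth step, as in [diamondSS]. *)
Lemma torus_ball_sub u d :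
  ball (@torus_adj m.+2 n.+2) setT u d \subset diamond u d.+1 :|: diamond u d.
Proof.
elim: d => [|d /subsetP IHd].
  rewrite /= sub1set in_setU; apply/orP; left; apply/diamondP.
  by exists 0%N, 0%N; split=> //; case: u => u1 u2 /=; congr pair; ring.
apply/subsetP => x /= /setIP[_ /closed_nbhdP[/IHd|[y /IHd]]].
  rewrite !in_setU => /orP[->|]; first by rewrite orbT.
  by move=> /(subsetP (diamondSS u d)) ->.
rewrite !in_setU => /orP[] yD yx.
  by rewrite (diamond_step yD yx).
by rewrite (diamond_step yD yx) orbT.
Qed.

Lemma card_torus_ball u d :
  (#|ball (@torus_adj m.+2 n.+2) setT u d| <= 2 * d ^ 2 + 2 * d + 1)%N.
Proof.
apply: leq_trans (subset_leq_card (torus_ball_sub u d)) _.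
apply: leq_trans (leq_card_setU _ _) _.
apply: leq_trans (leq_add (card_diamond u d.+1) (card_diamond u d)) _.
by rewrite -!mulnn; lia.
Qed.

End Torus.

(* pi_opt(T_{m,n}) >= (2/13) n m, i.e. every solvable distribution P on the
   torus satisfies |P| >= 2nm/13, written 13 |P| >= 2 n m over nat. *)
Theorem theorem5p6 (m n : nat) (hm : 5 <= m) (hn : 5 <= n)
  (P : distribution ('I_m * 'I_n)%type) :
  solvable (@torus_adj m n) P -> 2 * (n * m) <= 13 * dsize P.
Proof.
(* The successor form gives the coordinates their ring structure modulo the cycle lengths. *)
case: m hm P => [|[|m]] // _; case: n hn => [|[|n]] // _ P.
move=> /(solvable_size (@torus_adj_sym m n) (@card_torus_ball m n)).
by rewrite card_prod !card_ord (mulnC m.+2).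
Qed.
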